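(* Let $Y$ be a real topological vector space. (1) The class of lower semicontinuous translative functionals $$\{\varphi_{A,k}: A\subseteq Y,\ k\in Y\setminus\{0\},\ \varphi_{A,k}\text{ lower semicontinuous}\}$$ coincides with $$\{\varphi_{A,k}: A\subseteq Y,\ k\in Y\setminus\{0\},\ \operatorname{cl}A-\mathbb{R}_{>}k\subseteq A\}$$ and with $$\{\varphi_{A,k}: A\subseteq Y\text{ closed},\ k\in(-0^+A)\setminus\{0\}\}.$$ (2) The class of continuous translative functionals $$\{\varphi_{A,k}: A\subseteq Y,\ k\in Y\setminus\{0\},\ \varphi_{A,k}\text{ continuous}\}$$ coincides with $$\{\varphi_{A,k}: A\subseteq Y,\ k\in Y\setminus\{0\},\ \operatorname{cl}A-\mathbb{R}_{>}k\subseteq\operatorname{int}A\}$$ and with $$\{\varphi_{A,k}: A\subseteq Y\text{ closed},\ k\in Y\setminus\{0\},\ A-\mathbb{R}_{>}k\subseteq\operatorname{int}A\}.$$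
   Context: $\mathbb{R}_{+}=\{x\in\mathbb{R}:x\ge 0\}$, $\mathbb{R}_{>}=\{x\in\mathbb{R}:x>0\}$, $\overline{\mathbb{R}}=\mathbb{R}\cup\{-\infty,+\infty\}$, and $\inf\emptyset=+\infty$. For $B\subseteq\mathbb{R}$ and $k\in Y$, $Bk=\{bk:b\in B\}$. The recession cone of $A$ is $0^+A=\{u\in Y: A+\mathbb{R}_{+}u\subseteq A\}$, and $-0^+A=\{-u:u\in 0^+A\}$. $\operatorname{int}A$ and $\operatorname{cl}A$ are the topological interior and closure. For $A\subseteq Y$ and $k\in Y\setminus\{0\}$, the Gerstewitz functional $\varphi_{A,k}:Y\to\overline{\mathbb{R}}$ is $\varphi_{A,k}(y)=\inf\{t\in\mathbb{R}: y\in A+tk\}$. A function $\varphi:Y\to\overline{\mathbb{R}}$ is translative if there is some $k\in Y\setminus\{0\}$ with $\varphi(y+tk)=\varphi(y)+t$ for all $y\in Y$, $t\in\mathbb{R}$; the translative functions are exactly the functionals $\varphi_{A,k}$ with $A\subseteq Y$, $k\in Y\setminus\{0\}$. Continuity and lower semicontinuity are meant for functions on $Y$ with values in $\overline{\mathbb{R}}$ (with its usual order topology). The classes are sets of functions $Y\to\overline{\mathbb{R}}$. *)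

(* Defs.v *)
From mathcomp Require Import all_boot all_order all_algebra.
From mathcomp Require Import all_classical all_reals all_analysis.

Set Implicit Arguments.
Unset Strict Implicit.
Unset Printing Implicit Defensive.

Import Order.TTheory GRing.Theory Num.Theory.
Import numFieldNormedType.Exports.

Local Open Scope classical_set_scope.
Local Open Scope ring_scope.

Definition set_add (V : zmodType) (A B : set V) : set V :=
  [set a + b | a in A & b in B].

Definition set_opp (V : zmodType) (A : set V) : set V := [set - a | a in A].

Definition set_sub (V : zmodType) (A B : set V) : set V :=
  [set a - b | a in A & b in B].

Definition set_scale (R : realType) (V : lmodType R) (B : set R) (k : V) :
  set V := [set b *: k | b in B].

Definition recession_cone (R : realType) (V : lmodType R) (A : set V) : set V :=
  [set u : V | set_add A (set_scale [set t : R | 0 <= t] u) `<=` A].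

(* [ereal_inf set0 = +oo], so the value is [+oo] when no [t] qualifies. *)
Definition gerstewitz (R : realType) (V : lmodType R) (A : set V) (k : V)
    (y : V) : \bar R :=
  ereal_inf [set t%:E | t in [set t : R | set_add A [set t *: k] y]].

(* Main.v *)
(** The sublevel set B = {phi <= 0} of phi = phi_{A,k} satisfies phi_{B,k} = phi,
    because translativity gives y - t k \in B iff phi y <= t.  If phi is lower
    semicontinuous then B is closed and stable under -R_+ k; if phi is continuous
    then B - R_> k lies in the open set {phi < 0}, which is contained in B.
    Conversely, when t < t' the inclusion cl A - R_> k `<=` A pushes
    y - t k \in cl A into y - t' k \in A, so closedness of cl A (resp. openness
    of int A) makes the strict superlevel (resp. sublevel) sets of phi open. *)
Require Import Defs.
From mathcomp Require Import all_boot all_order all_algebra.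
From mathcomp Require Import all_classical all_reals all_analysis.

Set Implicit Arguments.
Unset Strict Implicit.
Unset Printing Implicit Defensive.

Import Order.TTheory GRing.Theory Num.Theory.
Import numFieldNormedType.Exports.

Local Open Scope classical_set_scope.
Local Open Scope ring_scope.

Section extended_real_functions.
Context {X : topologicalType} {R : realType}.
Implicit Types f : X -> \bar R.

Lemma continuous_lower_semicontinuous f :
  continuous f -> lower_semicontinuous f.
Proof.
move=> /continuousP fC; apply/lower_semicontinuousP => a.
exact: (fC _ (@open_ereal_gt_ereal _ a%:E)).
Qed.

(** Open rays with real endpoints suffice to test neighbourhoods in [\bar R]: a finite value needs
    one ray on each side, an infinite value a single ray. *)
Lemma lower_semicontinuous_continuous f : lower_semicontinuous f ->
  (forall a : R, open [set x | (f x < a%:E)%E]) -> continuous f.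
Proof.
move=> /lower_semicontinuousP fgt flt x U.
have gtP a : (a%:E < f x)%E -> \forall y \near x, (a%:E < f y)%E.
  by move=> afx; exact: open_nbhs_nbhs (conj (fgt a) afx).
have ltP a : (f x < a%:E)%E -> \forall y \near x, (f y < a%:E)%E.
  by move=> fxa; exact: open_nbhs_nbhs (conj (flt a) fxa).
rewrite {1}/nbhs /= /ereal_nbhs /=.
case fxE : (f x) => [r||].
- case=> e /= e0 eU.
  have rl : ((r - e)%:E < f x)%E by rewrite fxE lte_fin ltrBlDr ltrDl.
  have ru : (f x < (r + e)%:E)%E by rewrite fxE lte_fin ltrDl.
  (* The two real bounds rule out infinite values of [f y], so only the real case has to be compared
     with the ball. *)
  apply: filterS2 (gtP _ rl) (ltP _ ru) => y.
  rewrite /preimage /=; case: (f y) => [s||] //; rewrite !lte_fin => rs sr.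
  by apply: eU; rewrite /ball_ /= distrC ltr_distl rs sr.
- case=> M [_ MU]; apply: (filterS _ (gtP M _)) => [y /MU //|].
  by rewrite fxE ltry.
- case=> M [_ MU]; apply: (filterS _ (ltP M _)) => [y /MU //|].
  by rewrite fxE ltNyr.
Qed.

(** This turns the real upper bounds of a value back into the value, infinite ones included: [+oo]
    has no real upper bound and [-oo] has all of them. *)
Lemma ereal_inf_upper (x : \bar R) :
  ereal_inf [set t%:E | t in [set t : R | (x <= t%:E)%E]] = x.
Proof.
apply/eqP; rewrite eq_le; apply/andP; split; last first.
  by apply/ereal_infP => _ [t xt <-].
case: x => [r||]; [|by rewrite leey|].
  by apply: ereal_inf_lbound; exists r => /=.
rewrite leeNy_eq; apply/eqP/eq_ninfty => t.
by apply: ereal_inf_lbound; exists t; rewrite //= leNye.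
Qed.

End extended_real_functions.

Section gerstewitz_lmodule.
Context {R : realType} {V : lmodType R}.
Implicit Types (A : set V) (k y : V).

Lemma set_add1E A (v : V) : set_add A [set v] = [set y | A (y - v)].
Proof.
apply/seteqP; split=> [y [a Aa [_ -> <-]]|y Ay] /=; first by rewrite addrK.
by exists (y - v) => //; exists v => //; rewrite subrK.
Qed.

Lemma gerstewitzE A k y :
  gerstewitz A k y = ereal_inf [set t%:E | t in [set t : R | A (y - t *: k)]].
Proof.
by rewrite /gerstewitz; under [in LHS]eq_fun do rewrite set_add1E.
Qed.

Lemma gerstewitz_le A k y (t : R) :
  A (y - t *: k) -> (gerstewitz A k y <= t%:E)%E.
Proof. by move=> At; rewrite gerstewitzE; apply: ereal_inf_lbound; exists t. Qed.

Lemma gerstewitz_lt A k y (a : \bar R) : (gerstewitz A k y < a)%E ->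
  exists2 t : R, (t%:E < a)%E & A (y - t *: k).
Proof.
by rewrite gerstewitzE => /ereal_inf_ltP[_ [t At <-] ta]; exists t.
Qed.

(** Translativity needs only one inequality: if [t] is admissible for [z], then [t + r] is
    admissible for [z + r *: k]. The reverse inequality is the same one with shift [- s], started
    from [y + s *: k]. *)
Lemma gerstewitzD A k y (s : R) :
  gerstewitz A k (y + s *: k) = (gerstewitz A k y + s%:E)%E.
Proof.
have le_shift z r : (gerstewitz A k (z + r *: k) <= gerstewitz A k z + r%:E)%E.
  rewrite -leeBlDr// [leRHS]gerstewitzE; apply/ereal_infP => _ [t At <-].
  rewrite leeBlDr// -EFinD; apply: gerstewitz_le.
  by rewrite scalerDl opprD addrACA subrr addr0.
apply/eqP; rewrite eq_le le_shift /=.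
by rewrite -leeBrDr// -EFinN (le_trans _ (le_shift _ _))// scaleNr addrK.
Qed.

Lemma gerstewitz_sublevel A k :
  gerstewitz [set y | (gerstewitz A k y <= 0)%E] k = gerstewitz A k.
Proof.
apply/funext => y; rewrite gerstewitzE -[RHS]ereal_inf_upper.
congr (ereal_inf (image _ _)); apply/funext => t /=.
by rewrite -scaleNr gerstewitzD EFinN sube_le0.
Qed.

Lemma sub_ray_subsetP (A B : set V) k :
  set_sub A (set_scale [set t : R | 0 < t] k) `<=` B <->
  forall a t, A a -> 0 < t -> B (a - t *: k).
Proof.
split=> [AB a t Aa t0|AB _ [a Aa [_ [t t0 <-] <-]]]; last exact: AB.
by apply: AB; exists a => //; exists (t *: k) => //; exists t.
Qed.

Lemma opp_recession_coneP A k :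
  set_opp (recession_cone A) k <-> forall a t, A a -> 0 <= t -> A (a - t *: k).
Proof.
split=> [[u Au <-] a t Aa t0|Ak].
  apply: Au; exists a => //; exists (t *: u); first by exists t.
  by rewrite scalerN opprK.
exists (- k); rewrite ?opprK // => _ [a Aa [_ [t t0 <-] <-]].
by rewrite scalerN; apply: Ak.
Qed.

End gerstewitz_lmodule.

Section gerstewitz_topology.
Context {R : realType} {Y : topologicalLmodType R}.
Implicit Types (A : set Y) (k : Y).

Lemma open_translate A (v : Y) : open A -> open [set y | A (y - v)].
Proof.
move=> oA; apply: (@open_comp _ _ (fun y => y - v)) oA => y _.
apply: (@continuous_comp _ _ _ (fun y => (y, v)) (fun p => p.1 - p.2)).
  by apply: cvg_pair => //; exact: cvg_cst.
exact: sub_continuous.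
Qed.

Lemma lower_semicontinuous_gerstewitz A k :
  set_sub (closure A) (set_scale [set t : R | 0 < t] k) `<=` A ->
  lower_semicontinuous (gerstewitz A k).
Proof.
move=> /sub_ray_subsetP clA x a ax.
(* The slack [e] is spent in two halves: one to pass from [closure A] to [A] at [x], the other to
   keep the values near [x] strictly above [a]. *)
have [e e0 aex] : exists2 e : R, 0 < e & ((a + e)%:E < gerstewitz A k x)%E.
  apply/not_exists2P => aex; move: ax; rewrite ltNge => /negP; apply.
  apply/lee_addgt0Pr => e e0; rewrite leNgt; apply/negP => xe.
  by case: (aex e).
have e2 : 0 < e / 2 by rewrite divr_gt0.
exists [set y | (~` closure A) (y - (a + e / 2) *: k)].
  apply: open_nbhs_nbhs; split.
    by apply: open_translate; apply/closed_openC/closed_closure.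
  (* If [x] were outside this set, a further step [e / 2] along [- k] would land in [A] and give a
     value at most [a + e] at [x]. *)
  move=> /clA /(_ e2); rewrite -addrA -opprD -scalerDl -addrA -splitr.
  by move=> /gerstewitz_le; rewrite leNgt aex.
move=> y yA; apply: (@lt_le_trans _ _ (a + e / 2)%:E).
  by rewrite lte_fin ltrDl.
rewrite leNgt; apply/negP => /gerstewitz_lt[t ta At]; apply: yA.
(* Moving from level [t] down to level [a + e / 2] stays in [A], which contradicts the choice of [y]
   outside the translated closure. *)
have : 0 < a + e / 2 - t by rewrite subr_gt0 -lte_fin.
move=> /(clA _ _ (subset_closure At)); rewrite -addrA -opprD -scalerDl subrKC.
exact: subset_closure.
Qed.

Lemma continuous_gerstewitz A k :
  set_sub (closure A) (set_scale [set t : R | 0 < t] k) `<=` interior A ->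
  continuous (gerstewitz A k).
Proof.
move=> clA; apply: lower_semicontinuous_continuous.
  by apply: lower_semicontinuous_gerstewitz => y /clA; exact: interior_subset.
move: clA => /sub_ray_subsetP clA a; rewrite openE => x /gerstewitz_lt[t].
(* The midpoint [m] leaves room on both sides: [t < m] puts [x - m *: k] in the interior of [A], and
   [m < a] keeps the inequality strict at nearby points. *)
rewrite lte_fin => ta At; have [tm ma] := midf_lt ta.
set m := (t + a) / 2 in tm ma.
have mA : interior A (x - m *: k).
  rewrite -subr_gt0 in tm; have := clA _ _ (subset_closure At) tm.
  by rewrite -addrA -opprD -scalerDl subrKC.
have := open_translate (m *: k) (@open_interior _ A).
rewrite openE => /(_ x mA); apply: filterS => y /interior_subset Ay.
by apply: le_lt_trans (gerstewitz_le Ay) _; rewrite lte_fin.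
Qed.

Lemma closed_gerstewitz_sublevel A k : lower_semicontinuous (gerstewitz A k) ->
  closed [set y | (gerstewitz A k y <= 0)%E].
Proof.
move=> /lower_semicontinuousP /(_ 0) /open_closedC; congr closed.
by apply/seteqP; split=> y /=; rewrite leNgt => /negP.
Qed.

Lemma gerstewitz_sublevel_sub_open A k : continuous (gerstewitz A k) ->
  set_sub [set y | (gerstewitz A k y <= 0)%E] (set_scale [set t : R | 0 < t] k)
    `<=` interior [set y | (gerstewitz A k y <= 0)%E].
Proof.
move=> /continuousP fC; apply/sub_ray_subsetP => a t /= a0 t0.
apply: (@interiorS _ (gerstewitz A k @^-1` [set x | (x < 0)%E])).
  by move=> y /= /ltW.
have := fC _ (@open_ereal_lt_ereal _ 0%E); rewrite openE; apply.
rewrite /= -scaleNr gerstewitzD EFinN suber_lt0//.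
by apply: le_lt_trans a0 _; rewrite lte_fin.
Qed.

End gerstewitz_topology.

Theorem theorem4 (R : realType) (Y : topologicalLmodType R) :
  (   [set f : Y -> \bar R | exists (A : set Y) (k : Y),
         [/\ k != 0, lower_semicontinuous (gerstewitz A k)
           & f = gerstewitz A k]]
    = [set f : Y -> \bar R | exists (A : set Y) (k : Y),
         [/\ k != 0,
             set_sub (closure A) (set_scale [set t : R | 0 < t] k) `<=` A
           & f = gerstewitz A k]]
   /\ [set f : Y -> \bar R | exists (A : set Y) (k : Y),
         [/\ k != 0, lower_semicontinuous (gerstewitz A k)
           & f = gerstewitz A k]]
    = [set f : Y -> \bar R | exists (A : set Y) (k : Y),
         [/\ closed A, (set_opp (recession_cone A) `\ 0) k
           & f = gerstewitz A k]])
  /\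
  (   [set f : Y -> \bar R | exists (A : set Y) (k : Y),
         [/\ k != 0, continuous (gerstewitz A k)
           & f = gerstewitz A k]]
    = [set f : Y -> \bar R | exists (A : set Y) (k : Y),
         [/\ k != 0,
             set_sub (closure A) (set_scale [set t : R | 0 < t] k) `<=` interior A
           & f = gerstewitz A k]]
   /\ [set f : Y -> \bar R | exists (A : set Y) (k : Y),
         [/\ k != 0, continuous (gerstewitz A k)
           & f = gerstewitz A k]]
    = [set f : Y -> \bar R | exists (A : set Y) (k : Y),
         [/\ closed A, k != 0,
             set_sub A (set_scale [set t : R | 0 < t] k) `<=` interior A
           & f = gerstewitz A k]]).
Proof.
split; split; apply/seteqP; split=> f [A [k []]].
- move=> k0 fC ->; exists [set y | (gerstewitz A k y <= 0)%E], k; split=> //.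
    rewrite -(closure_id _).1; last exact: closed_gerstewitz_sublevel.
    apply/sub_ray_subsetP => a t /= a0 t0.
    rewrite -scaleNr gerstewitzD EFinN sube_le0// (le_trans a0)//.
    by rewrite lee_fin ltW.
  by rewrite gerstewitz_sublevel.
- move=> k0 clA ->; exists A, k; split=> //.
  exact: lower_semicontinuous_gerstewitz.
- move=> k0 fC ->; exists [set y | (gerstewitz A k y <= 0)%E], k; split.
  + exact: closed_gerstewitz_sublevel.
  + split; last exact/eqP.
    apply/opp_recession_coneP => a t /= a0 t0.
    by rewrite -scaleNr gerstewitzD EFinN sube_le0// (le_trans a0) ?lee_fin.
  + by rewrite gerstewitz_sublevel.
- move=> /closure_id clA [/opp_recession_coneP Ak /eqP k0] ->.
  (* A closed [A] equals its closure, so stability under all [t >= 0] contains the condition for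
     [t > 0] on [closure A]. *)
  exists A, k; split=> //; apply: lower_semicontinuous_gerstewitz.
  by rewrite -clA; apply/sub_ray_subsetP => a t Aa /ltW; exact: Ak.
- move=> k0 fC ->; exists [set y | (gerstewitz A k y <= 0)%E], k; split=> //.
    rewrite -(closure_id _).1; first exact: gerstewitz_sublevel_sub_open.
    exact/closed_gerstewitz_sublevel/continuous_lower_semicontinuous.
  by rewrite gerstewitz_sublevel.
- move=> k0 clA ->; exists A, k; split=> //; exact: continuous_gerstewitz.
- move=> k0 fC ->; exists [set y | (gerstewitz A k y <= 0)%E], k; split=> //.
  + exact/closed_gerstewitz_sublevel/continuous_lower_semicontinuous.
  + exact: gerstewitz_sublevel_sub_open.
  + by rewrite gerstewitz_sublevel.
- move=> /closure_id clA k0 Ak ->; exists A, k; split=> //.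
  by apply: continuous_gerstewitz; rewrite -clA.
Qed.
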